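(* Let $k\ge 2$ be an integer. For any $\epsilon>0$ there exists a constant $c>0$ such that, for all $m\ge k$, every simple $m\times\lfloor cm^{k-1}\rfloor$ matrix makes at least $m^{1-\epsilon}$ contributions.
   Context: All matrices have entries in $\{0,1\}$. A matrix is simple if its columns are pairwise distinct. For an $m\times n$ matrix $M$, $R\subseteq[m]=\{1,\dots,m\}$ and $C\subseteq[n]$, $M[R,C]$ denotes the $|R|\times|C|$ submatrix of $M$ with rows indexed by $R$ and columns indexed by $C$; $[a]^{(b)}$ denotes the set of $b$-element subsets of $[a]$. Fix $k$. For an $m\times n$ simple matrix $M$, a collection $(R_1,C_1),\dots,(R_i,C_i)\in[m]^{(k)}\times[n]^{(2^k)}$ is a set of $i$ contributions if $M[R_j,C_j]$ is a simple matrix for all $j\le i$ and, for any $j\ne j'$ with $R_j=R_{j'}$, either $\max C_j<\min C_{j'}$ or $\max C_{j'}<\min C_j$. For a real number $t\geq 0$, $M$ makes (at least) $t$ contributions if there exists a set of at least $t$ contributions for $M$. *)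

(* Defs.v *)
From HB Require Import structures.
From mathcomp Require Import all_boot all_order all_algebra.
From mathcomp Require Import reals exp.

Set Implicit Arguments.
Unset Strict Implicit.
Unset Printing Implicit Defensive.

Import Order.TTheory GRing.Theory Num.Theory.

Local Open Scope ring_scope.

(* {0,1}-matrices are encoded as boolean matrices. *)
Definition simple_mx (m n : nat) (M : 'M[bool]_(m, n)) : Prop :=
  injective (fun j : 'I_n => col j M).

(* [enum_val] lists a set of ordinals in increasing order, so the rows and
   columns of M[A, C] keep their relative order. *)
Definition submx_on (m n : nat) (M : 'M[bool]_(m, n))
    (A : {set 'I_m}) (C : {set 'I_n}) : 'M[bool]_(#|A|, #|C|) :=
  mxsub (fun i : 'I_#|A| => enum_val i) (fun j : 'I_#|C| => enum_val j) M.

Definition set_max (n : nat) (C : {set 'I_n}) : nat :=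
  (\max_(x in C) (x : nat))%N.

(* The default n exceeds every element of C, so this is min C whenever C is
   nonempty; below it is only used for sets with 2 ^ k elements. *)
Definition set_min (n : nat) (C : {set 'I_n}) : nat :=
  \big[minn/n]_(x in C) (x : nat).

Definition contributions (k m n : nat) (M : 'M[bool]_(m, n)) (i : nat)
    (A : 'I_i -> {set 'I_m}) (C : 'I_i -> {set 'I_n}) : Prop :=
  [/\ forall j : 'I_i, #|A j| = k,
      forall j : 'I_i, #|C j| = (2 ^ k)%N,
      forall j : 'I_i, simple_mx (submx_on M (A j) (C j))
    & forall j j' : 'I_i, j <> j' -> A j = A j' ->
        (set_max (C j) < set_min (C j'))%N \/
        (set_max (C j') < set_min (C j))%N].

Definition makes_contributions (R : realType) (k m n : nat)
    (M : 'M[bool]_(m, n)) (t : R) : Prop :=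
  exists (i : nat) (A : 'I_i -> {set 'I_m}) (C : 'I_i -> {set 'I_n}),
    contributions k M A C /\ t <= i%:R.

(* Main.v *)
(** Let f m be about c T m^(k-2+e), and suppose that a family of at least f m
    columns is distinct on m rows. If for every row r more than m^(k-2) pairs
    of columns differ in r only, then by Sauer's lemma these pairs shatter a
    (k-1)-set of other rows, so r lies in a shattered k-set; hence at least
    m / k different k-sets of rows contribute. Otherwise some row can be deleted
    at the cost of at most m^(k-2) columns, and f m - f (m-1) is at least
    m^(k-2) as soon as T >= m^(1-e). If T is large compared with m, cut the
    columns into two intervals and add up their contributions. In all cases the
    family makes at least T / 2k contributions. *)
Require Import Defs.
From HB Require Import structures.
From mathcomp Require Import all_boot all_order all_algebra.
From mathcomp Require Import reals exp.
From mathcomp Require Import zify ring lra.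

Set Implicit Arguments.
Unset Strict Implicit.
Unset Printing Implicit Defensive.

Import Order.TTheory GRing.Theory Num.Theory.

Local Open Scope ring_scope.

(** * Choosing one representative from each fibre of a function *)

(** Applied to trace maps: it thins a set of columns to distinct ones after a row is deleted, and
    picks one column per pattern on a shattered set. *)
Definition reps (T U : finType) (f : T -> U) (J : {set T}) : {set T} :=
  [set x in J | [pick z in J | f z == f x] == Some x].

Lemma reps_sub (T U : finType) (f : T -> U) (J : {set T}) : reps f J \subset J.
Proof. by apply/subsetP => x; rewrite inE => /andP[]. Qed.

Lemma reps_inj (T U : finType) (f : T -> U) (J : {set T}) :
  {in reps f J &, injective f}.
Proof.
move=> x y; rewrite !inE => /andP[_ /eqP px] /andP[_ /eqP py] fxy.
by move: px; rewrite fxy py => -[].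
Qed.

Lemma imset_reps (T U : finType) (f : T -> U) (J : {set T}) :
  f @: reps f J = f @: J.
Proof.
apply/eqP; rewrite eqEsubset imsetS ?reps_sub //=.
apply/subsetP => _ /imsetP[x Jx ->].
case E: [pick z in J | f z == f x] => [z|].
  have [Jz /eqP fz] : z \in J /\ f z == f x.
    by move: E; case: pickP => // w /andP[] ? ? [<-].
  by apply/imsetP; exists z => //; rewrite inE Jz fz E eqxx.
by move: E; case: pickP => // /(_ x); rewrite Jx eqxx.
Qed.

Lemma card_reps (T U : finType) (f : T -> U) (J : {set T}) :
  #|reps f J| = #|f @: J|.
Proof. by rewrite -imset_reps card_in_imset //; exact: reps_inj. Qed.

(** * Shattering, twins and Sauer's lemma *)

Definition shatters (T : finType) (F : {set {set T}}) (A : {set T}) : bool :=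
  powerset A \subset [set Y :&: A | Y in F].

(** These are the pairs of members of [F] differing in [r] only, each recorded by its element
    without [r]. *)
Definition twins (T : finType) (F : {set {set T}}) (r : T) : {set {set T}} :=
  [set Y in F | (r \notin Y) && (r |: Y \in F)].

(** Deleting [r] identifies two members of [F] exactly when they form a pair counted by [twins]. *)
Lemma card_twins (T : finType) (F : {set {set T}}) (r : T) :
  #|F| = (#|[set Y :\ r | Y in F]| + #|twins F r|)%N.
Proof.
have sub : twins F r \subset F by apply/subsetP => Y; rewrite inE => /andP[].
rewrite -(cardsID (twins F r) F) (setIidPr sub) addnC; congr (_ + _)%N.
have -> : [set Y :\ r | Y in F] = [set Y :\ r | Y in F :\: twins F r].
  apply/eqP; rewrite eqEsubset andbC imsetS ?subsetDl //=.
  apply/subsetP => _ /imsetP[Y FY ->].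
  case DY: (Y \in twins F r); last by apply: imset_f; rewrite inE DY.
  move: DY; rewrite inE FY /= => /andP[rY FrY].
  apply/imsetP; exists (r |: Y); first by rewrite !inE FrY eqxx.
  by rewrite setU1K //; apply/setDidPl; rewrite disjoint_sym disjoints1.
rewrite card_in_imset // => Y Z.
rewrite !inE => /andP[nY FY] /andP[nZ FZ] eYZ.
have key (U V : {set T}) : U \in F -> V \in F -> U :\ r = V :\ r ->
    r \notin U -> r \in V -> [&& U \in F, r \notin U & r |: U \in F].
  move=> FU FV e rU rV; rewrite FU rU /=.
  have -> : U = V :\ r by rewrite -e; apply/esym/setDidPl; rewrite disjoint_sym disjoints1.
  by rewrite setD1K.
have [rY|rY] := boolP (r \in Y); have [rZ|rZ] := boolP (r \in Z).
- by rewrite -(setD1K rY) eYZ setD1K.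
- by rewrite (key Z Y) in nZ.
- by rewrite (key Y Z) in nY.
- move/setP: eYZ => e; apply/setP => x; have := e x; rewrite !inE.
  by have [->|] //= := eqVneq x r; rewrite (negPf rY) (negPf rZ).
Qed.

(** Each twin is available both with and without [r], so every pattern on [A] extends in both ways
    at [r]. *)
Lemma shatters_twins (T : finType) (F : {set {set T}}) (r : T) (A : {set T}) :
  shatters (twins F r) A -> shatters F (r |: A).
Proof.
move=> /subsetP sh; apply/subsetP => X; rewrite inE => /subsetP XA.
have /imsetP[Y] : X :\ r \in [set Y :&: A | Y in twins F r].
  apply: sh; rewrite inE; apply/subsetP => x; rewrite !inE => /andP[xr /XA].
  by rewrite !inE (negPf xr).
rewrite inE => /and3P[FY rY FrY] /setP eX.
have [rX|rX] := boolP (r \in X).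
  apply/imsetP; exists (r |: Y) => //; apply/setP => x.
  have := eX x; rewrite !inE; have [->|_] /= := eqVneq x r; first by rewrite rX.
  by move=> ->.
apply/imsetP; exists Y => //; apply/setP => x.
have := eX x; rewrite !inE; have [->|_] /= := eqVneq x r.
  by rewrite (negPf rX) (negPf rY).
by move=> ->.
Qed.

(** For [d > 0] this is a closed form above the usual sum of the binomials [C(s, i)] with
    [i < d]. *)
Definition sauer_bound (d s : nat) : nat := if d is e.+1 then (s.+1 ^ e)%N else 0.

Lemma sauer_boundS (d s : nat) :
  (sauer_bound d.+1 s + sauer_bound d s <= sauer_bound d.+1 s.+1)%N.
Proof.
case: d => [|d] //=; rewrite !expnS -[X in (_ + X)%N]mul1n -mulnDl addn1.
by rewrite leq_mul2l; case: d => [|d]; rewrite ?expn0 ?leq_exp2r ?leqnSn.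
Qed.

(* Induction through card_twins: the twins of r must shatter a set of one
   element less, as r can be added to it. *)
Lemma sauer (T : finType) (d : nat) (S : {set T}) (F : {set {set T}}) :
  F \subset powerset S -> (sauer_bound d #|S| < #|F|)%N ->
  exists A : {set T}, [/\ A \subset S, #|A| = d & shatters F A].
Proof.
move: {2}#|S| (erefl #|S|) => s.
elim: s d S F => [|s IHs] [|d] S F cS FS.
(* For [d = 0] any nonempty family shatters the empty set. For [d > 0] and an empty ground set, at
   most one member is possible, which contradicts the bound. *)
1,3: move=> /card_gt0P[Y FY]; exists set0; split; rewrite ?sub0set ?cards0 //;
  rewrite /shatters powerset0 sub1set; apply/imsetP; exists Y => //; by rewrite setI0.
  move=> /=; rewrite cS exp1n => /leq_trans/(_ (subset_leq_card FS)).
  by rewrite card_powerset cS.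
move=> big.
have [r rS] : exists r, r \in S by apply/card_gt0P; rewrite cS.
have cSr : #|S :\ r| = s by have := cardsD1 r S; rewrite rS cS => -[].
have [big1|small1] := ltnP (sauer_bound d.+1 s) #|[set Y :\ r | Y in F]|.
  have [||A [AS cA /subsetP shA]] := IHs d.+1 (S :\ r) [set Y :\ r | Y in F] cSr.
  - apply/subsetP => _ /imsetP[Y FY ->]; rewrite inE setSD //.
    by have := subsetP FS _ FY; rewrite inE.
  - by rewrite cSr.
  have rA : r \notin A by apply/negP => /(subsetP AS); rewrite !inE eqxx.
  exists A; split => //; first exact: subset_trans AS (subD1set _ _).
  apply/subsetP => X /shA /imsetP[_ /imsetP[Y FY ->] ->].
  apply/imsetP; exists Y => //; apply/setP => x; rewrite !inE.
  by have [->|] //= := eqVneq x r; rewrite (negPf rA) andbF.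
have [||A [AS cA shA]] := IHs d (S :\ r) (twins F r) cSr.
- apply/subsetP => Y; rewrite !inE => /and3P[FY rY _]; rewrite subsetD1 rY andbT.
  by have := subsetP FS _ FY; rewrite inE.
- have := sauer_boundS d s; move: big; rewrite cS cSr (card_twins F r).
  by move: small1; lia.
have rA : r \notin A by apply/negP => /(subsetP AS); rewrite !inE eqxx.
exists (r |: A); split; last exact: shatters_twins.
  by rewrite subUset sub1set rS (subset_trans AS) ?subD1set.
by rewrite cardsU1 rA cA.
Qed.

(** * Columns as sets of rows, and families of contributions *)

(** A column becomes a subset of the fixed type of all rows, so deleting rows changes no types and
    Sauer's lemma applies directly. *)
Definition trace (m n : nat) (M : 'M[bool]_(m, n)) (S : {set 'I_m}) (j : 'I_n) :
  {set 'I_m} := [set i in S | M i j].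

Lemma traceI (m n : nat) (M : 'M[bool]_(m, n)) (S A : {set 'I_m}) (j : 'I_n) :
  A \subset S -> trace M S j :&: A = trace M A j.
Proof.
move=> /subsetP AS; apply/setP => i; rewrite !inE.
by case Ai: (i \in A); rewrite ?andbF ?andbT // AS.
Qed.

Lemma traceD1 (m n : nat) (M : 'M[bool]_(m, n)) (S : {set 'I_m}) (r : 'I_m)
    (j : 'I_n) : trace M S j :\ r = trace M (S :\ r) j.
Proof. by apply/setP => i; rewrite !inE andbA. Qed.

Definition before (n : nat) (C C' : {set 'I_n}) : Prop :=
  {in C & C', forall x y : 'I_n, (x < y)%N}.

(** Sets of pairs replace indexed families, and columns are confined to [J], so that families on
    successive intervals can be united. *)
Definition contribution_set (k m n : nat) (M : 'M[bool]_(m, n)) (J : {set 'I_n})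
    (P : {set {set 'I_m} * {set 'I_n}}) : Prop :=
  (forall p, p \in P -> [/\ p.2 \subset J, #|p.1| = k, #|p.2| = (2 ^ k)%N
                          & {in p.2 &, injective (trace M p.1)}]) /\
  {in P &, forall p q, p <> q -> p.1 = q.1 -> before p.2 q.2 \/ before q.2 p.2}.

Lemma contribution_set_sub (k m n : nat) (M : 'M[bool]_(m, n)) (J J' : {set 'I_n})
    (P : {set {set 'I_m} * {set 'I_n}}) :
  J \subset J' -> contribution_set k M J P -> contribution_set k M J' P.
Proof.
by move=> JJ' [PJ Psep]; split=> // p /PJ[pJ *]; split=> //; apply: subset_trans JJ'.
Qed.

(** The sizes add because column sets are nonempty: a pair in both families would have a column
    preceding itself. *)
Lemma contribution_setU (k m n : nat) (M : 'M[bool]_(m, n)) (J1 J2 : {set 'I_n})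
    (P1 P2 : {set {set 'I_m} * {set 'I_n}}) :
  before J1 J2 -> contribution_set k M J1 P1 -> contribution_set k M J2 P2 ->
  contribution_set k M (J1 :|: J2) (P1 :|: P2) /\
  #|P1 :|: P2| = (#|P1| + #|P2|)%N.
Proof.
move=> J12 [P1J P1sep] [P2J P2sep].
have cross p q : p \in P1 -> q \in P2 -> before p.2 q.2.
  move=> /P1J[/subsetP pJ _ _ _] /P2J[/subsetP qJ _ _ _] x y px qy.
  by apply: J12; [exact: pJ | exact: qJ].
split.
  split=> [p|p q].
    rewrite inE => /orP[/P1J|/P2J] [pJ *]; split=> //.
      exact: subset_trans pJ (subsetUl _ _).
    exact: subset_trans pJ (subsetUr _ _).
  rewrite !inE => /orP[Pp|Pp] /orP[Pq|Pq] npq epq.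
  - exact: P1sep.
  - by left; apply: cross.
  - by right; apply: cross.
  - exact: P2sep.
rewrite cardsU disjoint_setI0 ?cards0 ?subn0 //.
rewrite -setI_eq0; apply/eqP/setP => p; rewrite !inE; apply/negbTE/negP.
move=> /andP[Pp Pp']; have [_ _ cp _] := P1J p Pp.
have /card_gt0P[x px] : (0 < #|p.2|)%N by rewrite cp expn_gt0.
by have := cross p p Pp Pp' x x px px; rewrite ltnn.
Qed.

Lemma initial_segment (n : nat) (J : {set 'I_n}) (a : nat) : (a <= #|J|)%N ->
  exists J1 J2 : {set 'I_n},
    [/\ J = J1 :|: J2, before J1 J2, #|J1| = a & #|J2| = (#|J| - a)%N].
Proof.
move=> aJ.
suff [x cx] : exists x : nat, #|[set j in J | (j < x)%N]| = a.
  exists [set j in J | (j < x)%N], [set j in J | ~~ (j < x)%N]; split=> //.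
  - by apply/setP => j; rewrite !inE -andb_orr orbN andbT.
  - move=> i j; rewrite !inE -leqNgt => /andP[_ ix] /andP[_]; exact: leq_trans.
  - rewrite -(cardsID [set j : 'I_n | (j < x)%N] J) -[in RHS]cx.
    have -> : J :&: [set j : 'I_n | (j < x)%N] = [set j in J | (j < x)%N].
      by apply/setP => j; rewrite !inE.
    rewrite addKn; congr #|pred_of_set _|; apply/setP => j; rewrite !inE andbC //.
have full : #|[set j in J | (j < n)%N]| = #|J|.
  by congr #|pred_of_set _|; apply/setP => j; rewrite !inE ltn_ord andbT.
(* Raising the cut [x] by one adds at most one column, so no count between 0 and [#|J|] is
   skipped. *)
suff segP x : (a <= #|[set j in J | (j < x)%N]|)%N ->
    exists y : nat, #|[set j in J | (j < y)%N]| = a by apply: (segP n); rewrite full.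
elim: x => [|x IHx] ax.
  exists 0; apply/eqP; rewrite eqn_leq ax andbT.
  by rewrite eq_card0 // => j; rewrite !inE ltn0 andbF.
have [/IHx //|xa] := leqP a #|[set j in J | (j < x)%N]|.
exists x.+1; apply/eqP; rewrite eqn_leq ax andbT; apply: leq_trans xa.
have [xn|nx] := ltnP x n; last first.
  apply: leqW; apply: subset_leq_card; apply/subsetP => j; rewrite !inE.
  by move=> /andP[-> _]; apply: leq_trans (ltn_ord j) nx.
apply: leq_trans (_ : #|Ordinal xn |: [set j in J | (j < x)%N]| <= _)%N; last first.
  by rewrite cardsU1; case: (_ \notin _).
apply: subset_leq_card; apply/subsetP => j; rewrite !inE ltnS leq_eqVlt -val_eqE /=.
by case/andP=> -> /orP[->|->]; rewrite ?orbT.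
Qed.

Lemma contributions_of_set (R : realType) (k m n : nat) (M : 'M[bool]_(m, n))
    (J : {set 'I_n}) (P : {set {set 'I_m} * {set 'I_n}}) (t : R) :
  contribution_set k M J P -> t <= #|P|%:R -> makes_contributions k M t.
Proof.
move=> [PJ Psep] tP.
exists #|P|, (fun i => (enum_val i).1), (fun i => (enum_val i).2); split=> //.
split=> [i|i|i|i i' nii' eA].
- by have [] := PJ _ (enum_valP i).
- by have [] := PJ _ (enum_valP i).
- have [_ _ _ inj] := PJ _ (enum_valP i).
  move=> j j' /matrixP ecol; apply: enum_val_inj.
  apply: inj; [exact: enum_valP | exact: enum_valP |].
  apply/setP => r; rewrite !inE; case rA: (r \in _) => //=.
  have := ecol (enum_rank_in rA r) ord0.
  by rewrite !mxE !enum_rankK_in.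
have sepW p q : p \in P -> q \in P -> before p.2 q.2 ->
    (set_max p.2 < set_min q.2)%N.
  move=> /PJ[_ _ cp _] /PJ[_ _ cq _] bpq.
  have /card_gt0P[x0 px0] : (0 < #|p.2|)%N by rewrite cp expn_gt0.
  have max_lt (v : nat) : (forall x : 'I_n, x \in p.2 -> (x < v)%N) ->
      (set_max p.2 < v)%N.
    move=> H; rewrite /set_max; have v0 : (0 < v)%N by apply: leq_ltn_trans (H _ px0).
    by elim/big_ind: _ => // x y; rewrite gtn_max => -> ->.
  (* The default value [n] of the minimum is harmless, as every column index is below [n]. *)
  rewrite /set_min; elim/big_ind: _ => [|x y|y qy].
  - by apply: max_lt => x _; apply: ltn_ord.
  - by rewrite leq_min => -> ->.
  - by apply: max_lt => x px; apply: bpq.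
have [||] // := Psep _ _ (enum_valP i) (enum_valP i') _ eA.
- by move=> /enum_val_inj.
- by left; apply: sepW => //; exact: enum_valP.
- by right; apply: sepW => //; exact: enum_valP.
Qed.

(** * Counting contributions *)

(** Each shattered [k]-set gives one contribution, with one column chosen per pattern; the row sets
    differ, so no separation of columns is required. These sets cover [S], each with only [k]
    rows. *)
Lemma shattered_contributions (k m n : nat) (M : 'M[bool]_(m, n))
    (S : {set 'I_m}) (J : {set 'I_n}) :
  (forall r, r \in S -> exists A : {set 'I_m},
     [/\ r \in A, A \subset S, #|A| = k & shatters (trace M S @: J) A]) ->
  exists2 P, contribution_set k M J P & (#|S| <= k * #|P|)%N.
Proof.
move=> cov.
pose Q := [set A : {set 'I_m} | (#|A| == k) && (trace M A @: J == powerset A)].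
exists [set (A, reps (trace M A) J) | A in Q].
  split=> [p /imsetP[A] | p q /imsetP[A _ ->] /imsetP[B _ ->] /= nAB AB].
    rewrite inE => /andP[/eqP cA /eqP shA] -> /=; split=> //.
    - exact: reps_sub.
    - by rewrite card_reps shA card_powerset cA.
    - exact: reps_inj.
  by case: nAB; rewrite AB.
rewrite card_imset; last by move=> A B [].
apply: (@leq_trans #|cover Q|).
  apply: subset_leq_card; apply/subsetP => r /cov[A [rA AS cA /subsetP shA]].
  apply/bigcupP; exists A => //; rewrite inE cA eqxx eqEsubset /=.
  apply/andP; split; apply/subsetP => X.
    by move=> /imsetP[j _ ->]; rewrite inE; apply/subsetP => i; rewrite inE => /andP[].
  by move=> /shA /imsetP[_ /imsetP[j Jj ->] ->]; rewrite traceI // imset_f.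
rewrite mulnC -sum_nat_const; apply: leq_trans (leq_card_cover Q).1 _.
by apply: leq_sum => A; rewrite inE => /andP[/eqP-> _].
Qed.

(* A split into column intervals only occurs while T >= 2|S|; both parts then
   keep T >= |S|, so the growth condition for T is inherited from that for h.
   Writing the size condition with |J| + 1 makes it additive under integer
   splits. *)
Lemma many_contributions (R : realType) (d m n : nat) (M : 'M[bool]_(m, n))
    (h : nat -> R) (T : nat) (S : {set 'I_m}) (J : {set 'I_n}) :
  2 < h 0 ->
  (forall l, (l.+1 ^ d)%:R <= l.+1%:R * (h l.+1 - h l)) ->
  (0 < T)%N ->
  (forall l, (l < #|S|)%N -> (l.+1 ^ d)%:R <= T%:R * (h l.+1 - h l)) ->
  {in J &, injective (trace M S)} ->
  T%:R * h #|S| <= #|J|.+1%:R ->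
  exists2 P, contribution_set d.+2 M J P & (T <= 2 * d.+2 * #|P|)%N.
Proof.
move=> h0 hgrow.
have hpos l : 0 < h l.
  elim: l => [|l IHl]; first lra.
  suff: 0 <= h l.+1 - h l by lra.
  by rewrite -(pmulr_rge0 _ (ltr0Sn R l)); apply: le_trans (hgrow l).
(* A column split lowers [T] and a row deletion lowers [#|S|], so their sum serves as induction
   measure. *)
have [N] := ubnP (#|S| + T)%N; elim: N => // N IHN in T S J *.
rewrite ltnS => SN T0 hT inj bigJ.
(* Without rows, distinct traces leave at most one column, so [#|J|.+1 <= 2 < T * h 0], against the
   size condition. *)
have [S0|[r0 r0S]] := set_0Vmem S.
  have cJ : (#|J| <= 1)%N.
    rewrite leqNgt; apply/negP => /card_gt1P[x [y [Jx Jy]]].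
    by rewrite (inj x y) ?eqxx // S0; apply/setP => i; rewrite !inE.
  have : (#|J|.+1%:R : R) <= 2 by rewrite (ler_nat R _ 2).
  have : (1 : R) <= T%:R by rewrite ler1n.
  by move: bigJ; rewrite S0 cards0; nra.
have Spos : (0 < #|S|)%N by apply/card_gt0P; exists r0.
have [T2|T2] := leqP (2 * #|S|) T.
  have [T' eT] : exists T', T = (#|S| + T')%N by exists (T - #|S|)%N; lia.
  have TT : (T%:R : R) = #|S|%:R + T'%:R by rewrite eT natrD.
  have big_adm U : (#|S| <= U)%N ->
      forall l, (l < #|S|)%N -> (l.+1 ^ d)%:R <= U%:R * (h l.+1 - h l).
    move=> SU l lS; apply: le_trans (hgrow l) _.
    rewrite ler_wpM2r ?ler_nat; [| |exact: leq_trans SU] => //.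
    by rewrite -(pmulr_rge0 _ (ltr0Sn R l)); apply: le_trans (hgrow l).
  (* The first interval gets target [#|S|] and [a] columns, the ceiling of [#|S| * h #|S|] minus
     one: [a.+1] suffices for it, and as [a] is below that value, enough columns remain for the
     target [T']. *)
  have [a /andP[alt age]] : exists a : nat, a%:R < #|S|%:R * h #|S| <= a.+1%:R.
    have : 0 < #|S|%:R * h #|S| by rewrite mulr_gt0 ?ltr0n.
    have := ceil_itv (#|S|%:R * h #|S|); rewrite -ceil_gt0.
    by case: (Num.ceil _) => [[|a]|] // H _; exists a; move: H; rewrite -addn1 PoszD addrK.
  have T'pos : 0 <= T'%:R * h #|S| by rewrite mulr_ge0 // ltW.
  have aJ : (a <= #|J|)%N by rewrite -ltnS -(ltr_nat R); move: bigJ; rewrite TT; nra.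
  have [J1 [J2 [eJ J12 cJ1 cJ2]]] := initial_segment aJ.
  have inj1 : {in J1 &, injective (trace M S)}.
    by move=> x y Jx Jy; apply: inj; rewrite eJ inE ?Jx ?Jy.
  have inj2 : {in J2 &, injective (trace M S)}.
    by move=> x y Jx Jy; apply: inj; rewrite eJ inE ?Jx ?Jy orbT.
  have [|||||P1 cP1 bP1] := IHN #|S| S J1.
  - by move: SN Spos; lia.
  - by [].
  - exact: big_adm.
  - by [].
  - by rewrite cJ1.
  have [|||||P2 cP2 bP2] := IHN T' S J2.
  - by move: SN Spos; lia.
  - by lia.
  - by apply: big_adm; lia.
  - by [].
  - rewrite cJ2; move: alt bigJ; rewrite TT -!natr1 natrB // mulrDl; lra.
  have [cP bP] := contribution_setU J12 cP1 cP2.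
  exists (P1 :|: P2); first by rewrite eJ.
  by rewrite bP; move: bP1 bP2; rewrite eT; nia.
(* A row with few twins is deleted, keeping one column per remaining trace; the twins count the lost
   columns. *)
have [/existsP[r /andP[rS small]]|/existsPn big] :=
  boolP [exists r, (r \in S) && (#|twins (trace M S @: J) r| <= #|S| ^ d)%N].
  have cSr : (#|S| = #|S :\ r|.+1)%N by rewrite (cardsD1 r S) rS.
  pose J' := reps (trace M (S :\ r)) J.
  have cJ' : #|J| = (#|J'| + #|twins (trace M S @: J) r|)%N.
    rewrite -(card_in_imset inj) (card_twins (trace M S @: J) r) card_reps.
    by rewrite -imset_comp; congr (#|pred_of_set _| + _)%N; apply: eq_imset => j /=; rewrite traceD1.
  have [|||||P cP bP] := IHN T (S :\ r) J'.
  - by rewrite cSr in SN.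
  - by [].
  - by move=> l lS; apply: hT; rewrite cSr ltnW.
  - exact: reps_inj.
  (* The growth condition at [l = #|S| - 1] pays for the lost columns. *)
  - have := hT #|S :\ r|; rewrite cSr ltnSn => /(_ isT) step.
    have : (#|J|.+1%:R : R) <= #|J'|.+1%:R + (#|S :\ r|.+1 ^ d)%:R.
      by rewrite -natrD ler_nat cJ' addSn ltnS leq_add2l -cSr.
    move: bigJ; rewrite cSr; lra.
  exists P => //; apply: contribution_set_sub cP; exact: reps_sub.
(* Now each row [r] of [S] has more than [#|S| ^ d] twins, the Sauer bound for [d.+1] on the other
   [#|S| - 1] rows; adding [r] gives a shattered set of size [d.+2]. *)
have [r rS|P cP bP] := @shattered_contributions d.+2 m n M S J.
  have := big r; rewrite rS -ltnNge => bigr.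
  have cSr : (#|S| = #|S :\ r|.+1)%N by rewrite (cardsD1 r S) rS.
  have [||A [AS cA shA]] := @sauer _ d.+1 (S :\ r) (twins (trace M S @: J) r).
  - apply/subsetP => Y; rewrite !inE => /and3P[/imsetP[j _ ->] rY _].
    by rewrite subsetD1 rY andbT; apply/subsetP => i; rewrite inE => /andP[].
  - by rewrite /= -cSr.
  have rA : r \notin A by apply/negP => /(subsetP AS); rewrite !inE eqxx.
  exists (r |: A); split; rewrite ?setU11 ?cardsU1 ?rA ?cA //.
    by rewrite subUset sub1set rS (subset_trans AS) ?subD1set.
  exact: shatters_twins.
by exists P => //; move: bP T2; lia.
Qed.

(** * Increments of real powers *)

(** The chain is [(1-x)^e <= exp(-ex) <= 1/(1+ex) <= 1-ex/2], the last step because [ex <= 1]. The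
    case [x = 1] is separate, as [powR] is defined by cases at base 0. *)
Lemma powR_le_tangent (R : realType) (x e : R) : 0 <= x <= 1 -> 0 < e <= 1 ->
  (1 - x) `^ e <= 1 - e * x / 2.
Proof.
move=> /andP[x0 x1] /andP[e0 e1]; rewrite /powR.
have ex : 0 <= e * x <= 1 by apply/andP; split; nra.
have [_|x_neq1] := eqVneq (1 - x) 0; first by rewrite gt_eqF //=; lra.
have xlt1 : x < 1 by rewrite lt_neqAle x1 andbT; apply: contraNneq x_neq1 => ->; rewrite subrr.
apply: (@le_trans _ _ (sequences.expR (- (e * x)))).
  by rewrite ler_expR -mulrN ler_pM2l // le_ln1Dx //; lra.
rewrite expRN; apply: (@le_trans _ _ (1 + e * x)^-1).
  by rewrite lef_pV2 ?posrE ?expR_gt0 ?expR_ge1Dx //; lra.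
rewrite invf_ple ?posrE; [|lra|nra].
by rewrite -[X in X <= _]mul1r ler_pdivrMr; nra.
Qed.

Lemma powR_ge1 (R : realType) (a x : R) : 1 <= a -> 0 <= x -> 1 <= a `^ x.
Proof. by move=> a1 x0; rewrite -(powRr0 a) ler_powR. Qed.

(** Write [l = (l+1)(1-x)] with [x = 1/(l+1)] and apply the tangent estimate; [l = 0] is the case
    [x = 1]. *)
Lemma powR_increment (R : realType) (e : R) (l : nat) : 0 < e <= 1 ->
  e / 2 * l.+1%:R `^ e <= l.+1%:R * (l.+1%:R `^ e - l%:R `^ e).
Proof.
move=> e01; have a0 : (0 : R) < l.+1%:R by rewrite ltr0n.
have x01 : 0 <= (l.+1%:R^-1 : R) <= 1.
  by rewrite invr_ge0 ler0n invf_le1 ?ler1n.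
have -> : (l%:R : R) = l.+1%:R * (1 - l.+1%:R^-1).
  by rewrite mulrBr mulr1 divff ?gt_eqF // -natr1 addrK.
have x0 : (0 : R) <= 1 - l.+1%:R^-1 by rewrite subr_ge0; case/andP: x01.
rewrite (powRM e (ltW a0) x0).
have := powR_le_tangent x01 e01; set y := _ `^ e; set g := _ `^ e => yle.
have g0 : 0 <= g by exact: powR_ge0.
rewrite -[X in _ - X * _]/g -{2}[g]mulr1 -mulrBr.
apply: (@le_trans _ _ (l.+1%:R * (g * (e * l.+1%:R^-1 / 2)))).
  rewrite le_eqVlt; apply/orP; left; apply/eqP; field; rewrite nat1r; exact: lt0r_neq0.
by rewrite ler_pM2l // ler_wpM2l // lerBrDl -lerBrDr.
Qed.

(** * Choice of the constants *)

Theorem theorem3p5 (R : realType) (k : nat) (hk : (2 <= k)%N)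
    (eps : R) (heps : 0 < eps) :
  exists2 c : R, 0 < c &
    forall m : nat, (k <= m)%N ->
    forall n : nat, n%:Z = Num.floor (c * m%:R ^+ (k - 1)) ->
    forall M : 'M[bool]_(m, n), simple_mx M ->
      makes_contributions k M (m%:R `^ (1 - eps)).
Proof.
case: k hk => [|[|d]] // _; rewrite subn1 /=.
(* Capping the exponent at 1 only strengthens the conclusion, since [m >= 1]. *)
have [e [e01 e_eps]] : exists e : R, 0 < e <= 1 /\ e <= eps.
  have [h|h] := leP eps 1; first by exists eps; rewrite heps h.
  by exists 1; rewrite ltr01 lexx ltW.
have [e0 e1] := andP e01.
have C0 : 0 < 3 + 2 / e by rewrite addr_gt0 // divr_gt0.
(* The factor [4 * d.+2] comes from [T <= 4 * d.+2 * p], and [3 + 2 / e] from bounding [h m] by a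
   multiple of [m^(d+e)]. *)
exists (4 * d.+2%:R * (3 + 2 / e)); first by rewrite !mulr_gt0 ?ltr0n.
move=> m km n hn M simpleM.
have m1 : (1 : R) <= m%:R by rewrite ler1n; lia.
(* The summand 3 ensures [2 < h 0]; the factor [2 / e] cancels the [e / 2] of [powR_increment]. *)
pose h l : R := 3 + 2 / e * (l%:R ^+ d * l%:R `^ e).
have hstep l : l.+1%:R ^+ d * l.+1%:R `^ e <= l.+1%:R * (h l.+1 - h l).
  have inc := powR_increment l e01.
  have pw : (l%:R ^+ d : R) <= l.+1%:R ^+ d by rewrite lerXn2r ?nnegrE ?ler0n ?ler_nat.
  apply: (@le_trans _ _ (2 / e * (l.+1%:R ^+ d * (e / 2 * l.+1%:R `^ e)))).
    by rewrite le_eqVlt; apply/orP; left; apply/eqP; field; exact: lt0r_neq0.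
  have hinc : 2 / e * (l.+1%:R ^+ d * (l.+1%:R `^ e - l%:R `^ e)) <= h l.+1 - h l.
    rewrite /h opprD addrACA subrr add0r -mulrBr ler_pM2l ?divr_gt0 //.
    by rewrite mulrBr lerD2l lerN2 ler_wpM2r ?powR_ge0.
  apply: le_trans (ler_wpM2l (ler0n R l.+1) hinc).
  by rewrite [X in _ <= X]mulrCA ler_pM2l ?divr_gt0 // [X in _ <= X]mulrCA ler_wpM2l ?exprn_ge0.
have hgrow l : (l.+1 ^ d)%:R <= l.+1%:R * (h l.+1 - h l).
  apply: le_trans (hstep l); rewrite natrX ler_peMr ?exprn_ge0 //.
  by rewrite powR_ge1 ?ler1n // ltW.
pose p : R := m%:R `^ (1 - e); pose t := (Num.trunc p).+1.
have p1 : 1 <= p by rewrite powR_ge1 // subr_ge0.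
have /andP[tp pt] : (Num.trunc p)%:R <= p < t%:R by apply: truncn_itv; lra.
(* With this [T] the bound [T <= 2 * d.+2 * #|P|] becomes [t <= #|P|], and [t > p]. *)
pose T := (2 * d.+2 * t)%N.
have pT : p <= T%:R.
  by apply: le_trans (ltW pt) _; rewrite ler_nat /T leq_pmull.
have Tp : T%:R <= 4 * d.+2%:R * p.
  have tp2 : t%:R <= 2 * p by rewrite /t -natr1; lra.
  rewrite /T !natrM (_ : 4 = 2 * 2) -?mulrA ?ler_pM2l ?ltr0n //; last by ring.
  by rewrite [2 * (_ * p)]mulrCA ler_pM2l ?ltr0n.
have [|||||P cP bP] := @many_contributions R d m n M h T [set: 'I_m] [set: 'I_n] _ hgrow.
- by rewrite /h; have := powR_ge0 (0 : R) e; rewrite powR0 ?gt_eqF // !mulr0 addr0; lra.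
- by [].
- move=> l; rewrite cardsT card_ord => lm.
  have g0 : 0 < (l.+1%:R : R) `^ e by rewrite powR_gt0 ?ltr0n.
  have q0 : 0 <= (l.+1%:R : R) `^ (1 - e) by exact: powR_ge0.
  (* This splitting of [l+1] allows [(l+1)^e] to be cancelled in [hstep]; the other factor is at
     most [p <= T], as [l+1 <= m]. *)
  have lq : (l.+1%:R : R) `^ (1 - e) * l.+1%:R `^ e = l.+1%:R.
    by rewrite -powRD ?subrK ?powRr1 ?oner_eq0.
  have qT : (l.+1%:R : R) `^ (1 - e) <= T%:R.
    by apply: le_trans pT; rewrite ge0_ler_powR ?nnegrE ?ler_nat //; lra.
  have D0 : 0 <= h l.+1 - h l.
    by rewrite -(pmulr_rge0 _ (ltr0Sn R l)); apply: le_trans (hgrow l).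
  apply: (@le_trans _ _ ((l.+1%:R : R) `^ (1 - e) * (h l.+1 - h l))).
    rewrite -(ler_pM2r g0) natrX mulrAC lq; exact: hstep.
  by rewrite ler_wpM2r.
- move=> x y _ _ exy; apply: simpleM; apply/matrixP => i z.
  by move/setP/(_ i): exy; rewrite !mxE !inE.
- rewrite !cardsT !card_ord.
  (* The floor [n] may fall short of the real bound but [n + 1] exceeds it, which suits a size
     condition on [#|J|.+1]. *)
  have nbig : 4 * d.+2%:R * (3 + 2 / e) * m%:R ^+ d.+1 < n.+1%:R.
    by have -> : n.+1%:R = (n%:Z + 1)%:~R :> R; [rewrite intrD natr1 | rewrite hn floorD1_gt].
  apply: le_trans (ltW nbig).
  (* This lets the summand 3 of [h m] be absorbed into [3 * m^(d+e)]. *)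
  have md1 : 1 <= m%:R ^+ d * m%:R `^ e.
    rewrite -[X in X <= _]mulr1 ler_pM // ?exprn_ege1 //.
    by rewrite powR_ge1 // ltW.
  have pm : p * m%:R `^ e = m%:R.
    by rewrite -powRD ?subrK ?powRr1 ?oner_eq0 //; lra.
  apply: (@le_trans _ _ (4 * d.+2%:R * p * ((3 + 2 / e) * (m%:R ^+ d * m%:R `^ e)))).
    apply: ler_pM => //; first by rewrite addr_ge0 // mulr_ge0 ?divr_ge0 ?mulr_ge0 ?exprn_ge0 ?powR_ge0 // ltW.
    by rewrite /h [leRHS]mulrDl lerD2r; lra.
  have -> : m%:R ^+ d.+1 = p * m%:R `^ e * m%:R ^+ d :> R by rewrite pm exprS.
  by rewrite le_eqVlt; apply/orP; left; apply/eqP; ring.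
apply: (contributions_of_set cP).
have tP : (t <= #|P|)%N by move: bP; rewrite leq_pmul2l.
apply: (@le_trans _ _ p); first by rewrite ler_powR //; lra.
by apply: le_trans (ltW pt) _; rewrite ler_nat.
Qed.
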